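(* Let $G$ be a Garside group with Garside element $\Delta$, and let $g\in G$ be a slim, precentral periodic element. Then $$[g]^{\inf}=[g]^S=[g]^U=[g]^{St}.$$ In particular, $[g]^S$ is closed under any partial cycling.
   Context: Garside groups. In a monoid $M$, an atom is an element $a\neq 1$ such that $a=bc$ implies $b=1$ or $c=1$; $\Vert a\Vert$ is the supremum of the lengths of expressions of $a$ as products of atoms. $M$ is atomic if it is generated by its atoms and $\Vert a\Vert<\infty$ for all $a\in M$. Put $a\le_L b$ if $ac=b$ for some $c\in M$, and $a\le_R b$ if $ca=b$ for some $c\in M$. A Garside monoid is an atomic, left and right cancellative monoid $M$ such that $(M,\le_L)$ and $(M,\le_R)$ are lattices (with $\wedge_L$ the meet for $\le_L$) and $M$ contains a Garside element $\Delta$, i.e. an element such that for each $a\in M$, $a\le_L\Delta$ iff $a\le_R\Delta$, and the set $[1,\Delta]=\{a\in M: 1\le_L a\le_L\Delta\}$ is finite and generates $M$. A Garside group $G$ with Garside element $\Delta$ is the group of fractions of a Garside monoid $M=G^+$ with Garside element $\Delta$; $M$ is identified with its image in $G$. $G$ is taken nontrivial, so $\Delta\ne1$. Write $(1,\Delta)=[1,\Delta]\setminus\{1,\Delta\}$, $[1,\Delta)=[1,\Delta]\setminus\{\Delta\}$, $\tau(x)=\Delta^{-1}x\Delta$. Some positive power of $\Delta$ is central; $m$ is the smallest positive integer such that $\Delta^m$ is central. Normal form: every $g\in G$ has a unique decomposition $g=\Delta^u a_1\cdots a_\ell$ with $u\in\mathbb Z$, $\ell\ge0$, $a_i\in(1,\Delta)$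 and $(a_ia_{i+1}\cdots a_\ell)\wedge_L\Delta=a_i$ for all $i$. Then $\inf(g)=u$, $\sup(g)=u+\ell$. If $\ell\ge1$, the cycling of $g$ is $\mathbf c(g)=\Delta^u a_2\cdots a_\ell\tau^{-u}(a_1)$; set $\mathbf c(\Delta^u)=\Delta^u$. If $\ell\geq 1$ and $a_1=ba_1'$ with $b\in(1,\Delta)$, $a_1'\in[1,\Delta)$, the partial cycling of $g$ by $b$ is the conjugate $\tau^{-u}(b)^{-1}g\,\tau^{-u}(b)=\Delta^u a_1'a_2\cdots a_\ell\tau^{-u}(b)$. With $[g]$ the conjugacy class of $g$, let $\inf_s(g)=\max\{\inf(h):h\in[g]\}$, $\sup_s(g)=\min\{\sup(h):h\in[g]\}$, and $[g]^{\inf}=\{h\in[g]:\inf(h)=\inf_s(g)\}$; $[g]^S=\{h\in[g]:\inf(h)=\inf_s(g),\ \sup(h)=\sup_s(g)\}$; $[g]^U=\{h\in[g]^S:\mathbf c^k(h)=h\text{ for some }k\ge1\}$; $[g]^{St}=\{h\in[g]^S: h^k\in[g^k]^S\text{ for all }k\ge1\}$. Periodicity: $g$ is periodic if $g^k=\Delta^\ell$ for some integers $k\ne0$ and $\ell$. $g$ is $p/q$-periodic ($p\in\mathbb Z$, $q\in\mathbb Z_{\ge1}$) if $g^q$ is conjugate to $\Delta^p$ and $q$ is the smallest positive integer such that $g^q$ is conjugate to a power of $\Delta$. A $p/q$-periodic element is precentral if $p\equiv0\bmod m$, and slim if $p\equiv1\bmod q$. *)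

(* Defs.v *)
From HB Require Import structures.
From mathcomp Require Import all_boot all_order all_algebra.
From mathcomp Require Import boolp classical_sets cardinality.

Set Implicit Arguments.
Unset Strict Implicit.
Unset Printing Implicit Defensive.

Local Open Scope classical_set_scope.
Local Open Scope group_scope.

Section Lattice.
Variables (T : Type) (r : T -> T -> Prop).

Definition is_meet (a b d : T) : Prop :=
  [/\ r d a, r d b & forall c, r c a -> r c b -> r c d].

Definition is_join (a b d : T) : Prop :=
  [/\ r a d, r b d & forall c, r a c -> r b c -> r d c].

Record is_lattice : Prop := IsLattice {
  lattice_refl : forall a, r a a;
  lattice_anti : forall a b, r a b -> r b a -> a = b;
  lattice_trans : forall b a c, r a b -> r b c -> r a c;
  lattice_meet : forall a b, exists d, is_meet a b d;
  lattice_join : forall a b, exists d, is_join a b d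
}.

End Lattice.

Section GarsideMonoid.
Variable M : monoidType.
Implicit Types (a b c : M) (s : seq M).

Definition atom : set M :=
  [set a | a <> 1 /\ forall b c, a = b * c -> b = 1 \/ c = 1].

Definition expression (S : set M) a s : Prop :=
  {in s, forall x, S x} /\ a = \prod_(x <- s) x.

Definition generates (S : set M) : Prop :=
  forall a, exists s, expression S a s.

(* ||a|| is the supremum of the lengths of the expressions of a as products of
   atoms; it is finite iff these lengths are bounded. *)
Definition finite_norm a : Prop :=
  exists N : nat, forall s, expression atom a s -> size s <= N.

Definition atomic : Prop := generates atom /\ forall a, finite_norm a.

Definition leL a b : Prop := exists c, a * c = b.
Definition leR a b : Prop := exists c, c * a = b.

Definition simples (D : M) : set M := [set a | leL 1 a /\ leL a D].

Definition proper_simples (D : M) : set M := simples D `\` [set 1; D].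

Definition simples_neqD (D : M) : set M := simples D `\ D.

Record garside_element (D : M) : Prop := GarsideElement {
  garside_balanced : forall a, leL a D <-> leR a D;
  garside_finite : finite_set (simples D);
  garside_generates : generates (simples D)
}.

Record garside_monoid (D : M) : Prop := GarsideMonoid {
  garside_atomic : atomic;
  garside_cancelL : @right_injective M M M *%g;
  garside_cancelR : @left_injective M M M *%g;
  garside_latticeL : is_lattice leL;
  garside_latticeR : is_lattice leR;
  garside_elementP : garside_element D
}.

End GarsideMonoid.

Section Group.
Variable G : groupType.
Implicit Types x g h : G.

Definition zexpg x (k : int) : G :=
  match k with Posz n => x ^+ n | Negz n => x ^- n.+1 end.

Definition conj_class g : set G := [set h | exists x, h = g ^ x].

Definition central x : Prop := forall y, commute x y.

End Group.

(* By the Ore condition, an injective morphism iota such that every element of G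
   is a right fraction of iota's image makes G the group of fractions of M. *)
Record garside_group (M : monoidType) (G : groupType)
    (iota : UMagmaMorphism.type M G) (D : M) : Prop := GarsideGroup {
  garside_group_monoid : garside_monoid D;
  garside_group_inj : injective iota;
  garside_group_frac : forall g : G, exists a b, g = iota a / iota b;
  garside_group_nontrivial : exists g : G, g <> 1
}.

Section GarsideGroup.
Variables (M : monoidType) (G : groupType).
Variables (iota : UMagmaMorphism.type M G) (D : M).
Implicit Types (g h : G) (a b : M) (u p : int) (s : seq M) (q : nat).

Definition Dpow u : G := zexpg (iota D) u.

(* tau^k (x) = D^-k x D^k *)
Definition tau (k : int) (x : G) : G := x ^ Dpow k.

Definition is_normal_form g (us : int * seq M) : Prop :=
  [/\ g = Dpow us.1 * \prod_(a <- us.2) iota a,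
      {in us.2, forall a, proper_simples D a}
    & forall i, i < size us.2 ->
        is_meet (@leL M) (\prod_(a <- drop i us.2) a) D (nth 1 us.2 i)].

(* In a Garside group every element has exactly one normal form, so the default
   value (0, [::]) is never used. *)
Definition normal_form g : int * seq M :=
  xget (0%R, [::]) [set us | is_normal_form g us].

Definition ginf g : int := (normal_form g).1.
Definition gsup g : int := (ginf g + (size (normal_form g).2)%:Z)%R.

Definition cycling g : G :=
  let u := ginf g in
  if (normal_form g).2 is a :: s
  then Dpow u * \prod_(x <- s) iota x * tau (- u)%R (iota a)
  else Dpow u.

(* The partial cycling of g by b is defined: the first factor of the normal
   form of g is b * a' with b in (1, D) and a' in [1, D). *)
Definition partial_cycling_by g b : Prop :=
  exists a s a', [/\ (normal_form g).2 = a :: s, a = b * a',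
                     proper_simples D b & simples_neqD D a'].

Definition partial_cycling g b : G := g ^ tau (- ginf g)%R (iota b).

(* The maximum and the minimum exist in every Garside group; the default value
   0 is never used. *)
Definition inf_s g : int :=
  xget 0%R (let I := ginf @` conj_class g in [set u | I u /\ ubound I u]).
Definition sup_s g : int :=
  xget 0%R (let I := gsup @` conj_class g in [set u | I u /\ lbound I u]).

Definition inf_set g : set G :=
  [set h | conj_class g h /\ ginf h = inf_s g].

Definition super_summit g : set G :=
  [set h | [/\ conj_class g h, ginf h = inf_s g & gsup h = sup_s g]].

Definition ultra_summit g : set G :=
  [set h | super_summit g h /\ exists2 k, 0 < k & iter k cycling h = h].

Definition stable_summit g : set G :=
  [set h | super_summit g h /\
           forall k, 0 < k -> super_summit (g ^+ k) (h ^+ k)].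

Definition periodic g : Prop :=
  exists k l : int, k <> 0%R /\ zexpg g k = Dpow l.

Definition pq_periodic p q g : Prop :=
  [/\ 0 < q, conj_class (Dpow p) (g ^+ q)
    & forall k, 0 < k -> (exists l, conj_class (Dpow l) (g ^+ k)) -> q <= k].

(* The least positive m such that D^m is central in G.
   Such an m exists in every Garside group; the default value 0 is never used. *)
Definition central_exponent : nat :=
  let C := [set k : nat | 0 < k /\ central (iota D ^+ k)] in
  xget 0 [set m | C m /\ forall k, C k -> m <= k].

Definition precentral g : Prop :=
  exists p q, pq_periodic p q g /\ (p = 0 %[mod central_exponent])%Z.

Definition slim g : Prop :=
  exists p q, pq_periodic p q g /\ (p = 1 %[mod q])%Z.

End GarsideGroup.

(* Main.v *)
Require Import Defs.
From HB Require Import structures.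
From mathcomp Require Import all_boot all_order all_algebra.
From mathcomp Require Import boolp classical_sets cardinality.
From mathcomp Require Import zify ring.

(* Write g^q = D^p, which is central, with p = uq + 1. The class of g contains an
   element h with D^u <= h. Every such h satisfies D^v <= h^k <= D^(v+e) for
   all k, where v and v + e are the floor and the ceiling of pk/q: the lower
   bound is D^(ur) <= h^r for r = k mod q, and the upper bound follows from the
   lower bound on h^(q-r), since h^r h^(q-r) = D^p and p - u(q-r) = ur + 1.
   Conversely any f with f^q = D^(pk) has q inf(f) <= pk <= q sup(f). So the
   bounds are attained, every power of h is super summit, and all the summit
   sets of g consist of the elements h of [g] with D^u <= h. As h has at most
   one non-trivial factor, cycling is conjugation by a power of D. *)

Set Implicit Arguments.
Unset Strict Implicit.
Unset Printing Implicit Defensive.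

Import Order.TTheory GRing.Theory Num.Theory.

Local Open Scope classical_set_scope.
Local Open Scope group_scope.

(** * Integer powers and conjugacy classes in a group *)

Section IntegerPowers.
Variable G : groupType.
Implicit Types (x y : G) (k l : int).

Lemma zexpgD1 x k : zexpg x (k + 1)%R = zexpg x k * x.
Proof.
case: k => [n|[|n]].
- by rewrite -PoszD addn1 /= expgSr.
- by rewrite /= mulVg.
- have -> : (Negz n.+1 + 1)%R = Negz n by lia.
  by rewrite /zexpg [x ^+ n.+2]expgS invgM mulgVK.
Qed.

Lemma zexpgB1 x k : zexpg x (k - 1)%R = zexpg x k * x^-1.
Proof. by rewrite -{2}(subrK 1%R k) zexpgD1 mulgK. Qed.

Lemma zexpgD x k l : zexpg x (k + l)%R = zexpg x k * zexpg x l.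
Proof.
elim: l => [|n IH|n IH]; first by rewrite addr0 mulg1.
- by rewrite -addn1 PoszD addrA !zexpgD1 IH mulgA.
- by rewrite -addn1 PoszD opprD addrA !zexpgB1 IH mulgA.
Qed.

Lemma zexpgN x k : zexpg x (- k)%R = (zexpg x k)^-1.
Proof. by apply/esym/mulg1_eq; rewrite -zexpgD subrr. Qed.

Lemma zexpgMn x k n : zexpg x (k * n%:Z)%R = zexpg x k ^+ n.
Proof.
elim: n => [|n IH]; first by rewrite mulr0.
by rewrite intS mulrDr mulr1 zexpgD IH expgS.
Qed.

Lemma zexpgM x k l : zexpg x (k * l)%R = zexpg (zexpg x k) l.
Proof.
case: l => n; first exact: zexpgMn.
by rewrite NegzE mulrN !zexpgN zexpgMn.
Qed.

Lemma zexpg_commute x k l : commute (zexpg x k) (zexpg x l).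
Proof. by rewrite /commute -!zexpgD addrC. Qed.

Lemma zexpgC_central x y k : central x -> commute (zexpg x k) y.
Proof.
move=> cx; apply: commute_sym; case: k => n /=.
  by apply/commuteX/commute_sym/cx.
by apply/commuteV/commuteX/commute_sym/cx.
Qed.

Lemma conjg_central x y : central x -> x ^ y = x.
Proof. by move=> cx; rewrite conjgE cx mulKg. Qed.

Lemma conj_class_central x y : central x -> conj_class x y -> y = x.
Proof. by move=> cx [z ->]; rewrite conjg_central. Qed.

Lemma conj_classX x y n : conj_class x y -> conj_class (x ^+ n) (y ^+ n).
Proof. by case=> z ->; exists z; rewrite conjXg. Qed.

Lemma conj_class_sym x y : conj_class x y -> conj_class y x.
Proof. by case=> z ->; exists z^-1; rewrite conjgK. Qed.

Lemma conj_class_trans y x z :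
  conj_class x y -> conj_class y z -> conj_class x z.
Proof. by case=> a -> [b ->]; exists (a * b); rewrite conjgM. Qed.

Lemma conj_classJ x y z : conj_class x y -> conj_class x (y ^ z).
Proof. by move=> cxy; apply: conj_class_trans cxy _; exists z. Qed.

End IntegerPowers.

(** * Simple elements and atom lengths in a Garside monoid *)

Section GarsideMonoidTheory.
Variables (M : monoidType) (D : M).
Hypothesis hM : garside_monoid D.
Implicit Types (a b c : M).

Lemma leL1 a : leL 1 a. Proof. by exists a; rewrite mul1g. Qed.

Lemma mulM_eq1 a b : a * b = 1 -> a = 1.
Proof.
by move=> ab; apply: (lattice_anti (garside_latticeL hM)); [exists b|apply: leL1].
Qed.

Lemma simple_ind (P : M -> Prop) : P 1 ->
  (forall s a, leL s D -> P a -> P (s * a)) -> forall a, P a.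
Proof.
move=> P1 PM a.
have [s [sD ->]] := garside_generates (garside_elementP hM) a.
elim: s sD => [|x s IH] sD; first by rewrite big_nil.
rewrite big_cons; apply: PM; last first.
  by apply: IH => y ys; apply: sD; rewrite inE ys orbT.
by have [] := sD x (mem_head _ _).
Qed.

(** For a simple [s] with [s c = D], balance makes [c] a left divisor of [D] as well, say [c d = D],
    and then [s D = s c d = D d]. *)
Lemma garside_pushr a : exists b, a * D = D * b.
Proof.
elim/simple_ind: a => [|s a [t tD] [b ab]].
  by exists 1; rewrite mul1g mulg1.
have [c cD] : leL s D by exists t.
have [d dD] : leL c D.
  by apply/(garside_balanced (garside_elementP hM)); exists s.
by exists (d * b); rewrite -mulgA ab -{1}dD !mulgA cD.
Qed.

Lemma garside_pushl a : exists b, D * a = b * D.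
Proof.
elim/simple_ind: a => [|s a sD [b ab]].
  by exists 1; rewrite mul1g mulg1.
have [c cD] : leR s D by apply/(garside_balanced (garside_elementP hM)).
have [d dD] : leR c D.
  by apply/(garside_balanced (garside_elementP hM)); exists s.
by exists (d * b); rewrite -mulgA -ab mulgA -{1}dD -[d * c * s]mulgA cD mulgA.
Qed.

Lemma garside_eq1 : D = 1 -> forall a, a = 1.
Proof.
move=> D1; apply: simple_ind => // s a [t]; rewrite D1 => st ->.
by rewrite mulg1 (mulM_eq1 st).
Qed.

(** A leading simple factor of [a] divides both [a] and [D], hence is trivial, and the induction
    drops it. *)
Lemma meet_garside_eq1 a : is_meet (@leL M) a D 1 -> a = 1.
Proof.
elim/simple_ind: a => // s a sD IH [_ _ meetP].
have [t st] : leL s 1 by apply: meetP => //; exists a.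
rewrite (mulM_eq1 st) mul1g; apply: IH; split=> [||c ca cD]; try exact: leL1.
by apply: meetP => //; rewrite (mulM_eq1 st) mul1g.
Qed.

Lemma expressionM (S : set M) a b s t :
  expression S a s -> expression S b t -> expression S (a * b) (s ++ t).
Proof.
move=> [sS ->] [tS ->]; split; last by rewrite big_cat.
by move=> x; rewrite mem_cat => /orP[/sS|/tS].
Qed.

Lemma atom_expression_gt0 a s :
  a <> 1 -> expression (@atom M) a s -> 0 < size s.
Proof. by case: s => // a1 [_]; rewrite big_nil. Qed.

(** Prefixing an expression of [b] by one of [a] adds at least one atom. The decreasing bound is the
    termination measure for building normal forms. *)
Lemma factors_bounded N a b : a <> 1 ->
  (forall s, expression (@atom M) (a * b) s -> size s <= N.+1) ->
  forall s, expression (@atom M) b s -> size s <= N.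
Proof.
move=> a1 bnd s es; have [t et] := (garside_atomic hM).1 a.
have := bnd _ (expressionM et es); rewrite size_cat.
by have := atom_expression_gt0 a1 et; lia.
Qed.

Lemma norm0_eq1 a : (forall s, expression (@atom M) a s -> size s <= 0) -> a = 1.
Proof.
move=> bnd; have [s es] := (garside_atomic hM).1 a.
by apply: contrapT => /atom_expression_gt0 /(_ es); have := bnd s es; lia.
Qed.

End GarsideMonoidTheory.

(** * The left-invariant order on the Garside group *)

Section GarsideGroupOrder.
Variables (M : monoidType) (G : groupType).
Variables (iota : UMagmaMorphism.type M G) (D : M).
Hypothesis hG : garside_group iota D.
Implicit Types (a b : M) (f g h x y z : G) (k l u v w : int).

Let hM : garside_monoid D := garside_group_monoid hG.

Local Notation "'Dp' k" := (Dpow iota D k) (at level 10, k at level 9).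

Definition positive x : Prop := exists a, iota a = x.

(** Extends [leL] from [M] to its group of fractions. *)
Definition leG x y : Prop := positive (x^-1 * y).

Lemma positiveM x y : positive x -> positive y -> positive (x * y).
Proof. by move=> [a <-] [b <-]; exists (a * b); rewrite gmulfM. Qed.

Lemma positiveJ x k : positive x -> positive (x ^ Dp k).
Proof.
move=> px; elim: k => [|n [b xb]|n [b xb]]; first by rewrite conjg1.
- have [c bc] := garside_pushr hM b; exists c.
  rewrite -addn1 PoszD /Dpow zexpgD1 conjgM -xb conjgE.
  by rewrite -gmulfM bc gmulfM mulKg.
- have [c bc] := garside_pushl hM b; exists c.
  rewrite -addn1 PoszD opprD /Dpow zexpgB1 conjgM -xb conjgE invgK.
  by rewrite mulgA -gmulfM bc gmulfM mulgK.
Qed.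

Lemma leG_refl x : leG x x.
Proof. by exists 1; rewrite mulVg gmulf1. Qed.

Lemma leG_trans y x z : leG x y -> leG y z -> leG x z.
Proof.
move=> xy yz; have := positiveM xy yz.
by rewrite /leG -!mulgA mulVKg.
Qed.

Lemma leG_mul2l z x y : leG (z * x) (z * y) <-> leG x y.
Proof. by rewrite /leG invgM -mulgA mulKg. Qed.

Lemma leG_mulr_pos x y : positive y -> leG x (x * y).
Proof. by rewrite /leG mulKg. Qed.

(** Conjugation by powers of [D] preserves positive elements, so the left-invariant order also
    respects right multiplication by such powers. *)
Lemma leG_mulDpow x y k : leG x y -> leG (x * Dp k) (y * Dp k).
Proof.
by move=> /positiveJ -/(_ k); rewrite /leG conjgE invgM !mulgA.
Qed.

Lemma leG_iota a b : leG (iota a) (iota b) <-> leL a b.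
Proof.
split=> [[c]|[c <-]]; last by rewrite gmulfM; apply: leG_mulr_pos; exists c.
move=> e; exists c; apply: (garside_group_inj hG).
by rewrite gmulfM e mulVKg.
Qed.

Lemma garside_neq1 : D <> 1.
Proof.
move=> D1; have [x []] := garside_group_nontrivial hG.
have [a [b ->]] := garside_group_frac hG x.
by rewrite (garside_eq1 hM D1 a) (garside_eq1 hM D1 b) mulgV.
Qed.

Lemma positive_Dpow k : (0 <= k)%R -> positive (Dp k).
Proof. by case: k => // n _; exists (D ^+ n); rewrite gmulfXn. Qed.

Lemma leG_Dpow k l : leG (Dp k) (Dp l) <-> (k <= l)%R.
Proof.
rewrite /leG /Dpow -zexpgN -zexpgD addrC; split=> [[c ec]|kl]; last first.
  by apply: positive_Dpow; rewrite subr_ge0.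
rewrite leNgt; apply/negP => lk; apply: garside_neq1.
(* If [l < k], then 1 is the product of [D], D^(k-l-1) and D^(l-k), all positive, so [D] would be
   1. *)
have [d ed] : positive (Dp (k - l - 1)%R) by apply: positive_Dpow; lia.
apply: (@mulM_eq1 _ _ hM _ (d * c)); apply: (garside_group_inj hG).
rewrite !gmulfM ec ed gmulf1 /Dpow -[X in X * _]/(zexpg (iota D) 1%R) -!zexpgD.
by have -> : (1 + (k - l - 1 + (l - k)))%R = 0%R by lia.
Qed.

(** Only a power of [D] is multiplied on the right: D^u D^(un) <= f D^(un) <= f f^n. *)
Lemma leG_DpowX u f n : leG (Dp u) f -> leG (Dp (u * n%:Z)%R) (f ^+ n).
Proof.
move=> uf; elim: n => [|n IH]; first by rewrite mulr0; apply: leG_refl.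
rewrite expgS intS mulrDr mulr1 /Dpow zexpgD.
by apply: leG_trans (leG_mulDpow _ uf) _; apply/leG_mul2l.
Qed.

Lemma leG_XDpow w f n : leG f (Dp w) -> leG (f ^+ n) (Dp (w * n%:Z)%R).
Proof.
move=> fw; elim: n => [|n IH]; first by rewrite mulr0; apply: leG_refl.
rewrite expgS intS mulrDr mulr1 /Dpow zexpgD.
by apply: leG_trans (leG_mulDpow _ fw); apply/leG_mul2l.
Qed.

Lemma iota_leG_Dpow a : exists n : nat, leG (iota a) (Dp n%:Z).
Proof.
elim/(simple_ind hM): a => [|s a sD [n an]].
  by exists 0%N; rewrite gmulf1; apply: leG_refl.
exists n.+1; rewrite gmulfM intS /Dpow zexpgD.
apply: (@leG_trans (iota s * Dp n%:Z)); first exact/leG_mul2l.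
exact/leG_mulDpow/leG_iota.
Qed.

(** The denominator [b] divides some D^n, so [x] is a positive element times D^(-n), and conjugation
    by a power of [D] moves this factor to the left. *)
Lemma Dpow_leG x : exists k, leG (Dp k) x.
Proof.
have [a [b ->]] := garside_group_frac hG x.
have [n [c ec]] := iota_leG_Dpow b.
have -> : iota a / iota b = iota (a * c) * Dp (- n%:Z)%R.
  by rewrite gmulfM ec /Dpow zexpgN !mulgA mulgK.
exists (- n%:Z)%R; rewrite /leG -conjgE.
by apply: positiveJ; exists (a * c).
Qed.

(** Translation by a common lower bound D^m carries both elements into [M], where joins exist. It
    carries every common upper bound into [M] too, so the join of [M] is also the join in [G]. *)
Lemma joinG x y : exists z, is_join leG x y z.
Proof.
have [k kx] := Dpow_leG x; have [l ly] := Dpow_leG y.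
pose m := Num.min k l.
have [a ea] : leG (Dp m) x by apply: leG_trans kx; apply/leG_Dpow; lia.
have [b eb] : leG (Dp m) y by apply: leG_trans ly; apply/leG_Dpow; lia.
have [c [ac bc cP]] := lattice_join (garside_latticeL hM) a b.
have -> : x = Dp m * iota a by rewrite ea mulVKg.
have -> : y = Dp m * iota b by rewrite eb mulVKg.
exists (Dp m * iota c); split; try exact/leG_mul2l/leG_iota.
move=> z; rewrite -[z](mulVKg (Dp m)) !leG_mul2l => az bz.
have [d ed] : positive ((Dp m)^-1 * z).
  rewrite -[_ * z](mulVKg (iota a)); apply: positiveM az.
  by exists a.
by move: az bz; rewrite -ed !leG_iota; apply: cP.
Qed.

Lemma join_upto (F : nat -> G) n : exists z,
  (forall i, (i <= n)%N -> leG (F i) z) /\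
  forall y, (forall i, (i <= n)%N -> leG (F i) y) -> leG z y.
Proof.
elim: n => [|n [z [ubz lubz]]].
  exists (F 0%N); split=> [i|y]; last exact.
  by rewrite leqn0 => /eqP->; apply: leG_refl.
have [t [zt Ft tP]] := joinG z (F n.+1).
exists t; split=> [i|y uby].
  by rewrite leq_eqVlt => /orP[/eqP->//|/ubz Fz]; apply: leG_trans Fz zt.
by apply: tP (uby _ (leqnn _)); apply: lubz => i /leqW; apply: uby.
Qed.

(** * Existence of normal forms, and inf and sup in terms of the order *)

(** Greedy decomposition: the first factor is the meet of [b] with [D], and the recursion treats the
    remainder, whose atom length is smaller. *)
Lemma normal_form_monoid N b :
  (forall s, expression (@atom M) b s -> (size s <= N)%N) -> ~ leL D b ->
  exists s, [/\ b = \prod_(a <- s) a,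
      {in s, forall a, proper_simples D a}
    & forall i, (i < size s)%N ->
        is_meet (@leL M) (\prod_(a <- drop i s) a) D (nth 1 s i)].
Proof.
elim: N b => [|N IH] b bnd nDb.
  by exists [::]; split; rewrite // (norm0_eq1 hM bnd) big_nil.
have [a [ab aD aP]] := lattice_meet (garside_latticeL hM) b D.
have [a1|a1] := pselect (a = 1).
  exists [::]; split; rewrite // big_nil; apply: (meet_garside_eq1 hM).
  by rewrite -a1.
have [c ec] := ab; rewrite -ec in bnd.
(* A factor [D] of the remainder could be pushed left past [a], and [D] would divide [b]. *)
have nDc : ~ leL D c.
  case=> d ed; apply: nDb; rewrite -ec -ed.
  have [a' ea'] := garside_pushr hM a.
  by exists (a' * d); rewrite !mulgA ea'.
have [s [es ps ms]] := IH c (factors_bounded hM a1 bnd) nDc.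
exists (a :: s); split.
- by rewrite big_cons -es.
- move=> x; rewrite inE => /orP[/eqP->|/ps//].
  split; first by split=> //; apply: leL1.
  by case=> [//|aDE]; apply: nDb; rewrite -aDE.
- case=> [|i] /= si; last exact: ms.
  by rewrite big_cons -es ec.
Qed.

Lemma garside_power_split N b :
  (forall s, expression (@atom M) b s -> (size s <= N)%N) ->
  exists n c, b = D ^+ n * c /\ ~ leL D c.
Proof.
elim: N b => [|N IH] b bnd; have [[c ec]|nDb] := pselect (leL D b).
- exfalso; apply: garside_neq1; move: ec.
  by rewrite (norm0_eq1 hM bnd) => /(mulM_eq1 hM).
- by exists 0%N, b; rewrite mul1g.
- rewrite -ec in bnd *.
  have [n [d [-> nDd]]] := IH c (factors_bounded hM garside_neq1 bnd).
  by exists n.+1, d; rewrite expgS mulgA.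
- by exists 0%N, b; rewrite mul1g.
Qed.

Lemma normal_form_exists f : exists us, is_normal_form iota D f us.
Proof.
have [k [a ea]] := Dpow_leG f.
have [N bnd] := (garside_atomic hM).2 a.
have [n [b [eb nDb]]] := garside_power_split bnd.
have [N' bnd'] := (garside_atomic hM).2 b.
have [s [es ps ms]] := normal_form_monoid bnd' nDb.
exists ((k + n%:Z)%R, s); split=> //=.
rewrite -gmulf_prod -es /Dpow zexpgD -mulgA /= -gmulfXn -gmulfM -eb ea.
by rewrite mulVKg.
Qed.

Lemma normal_formP f : is_normal_form iota D f (normal_form iota D f).
Proof. exact: xgetPex (normal_form_exists f). Qed.

Lemma ginf_leG f : leG (Dp (ginf iota D f)) f.
Proof.
have [ef _ _] := normal_formP f; rewrite {2}ef -gmulf_prod.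
by apply: leG_mulr_pos; exists (\prod_(a <- (normal_form iota D f).2) a).
Qed.

Lemma leG_gsup f : leG f (Dp (gsup iota D f)).
Proof.
have [ef pf _] := normal_formP f; rewrite {1}ef /gsup /Dpow zexpgD.
apply/leG_mul2l; elim: (_.2) pf => [|a s IH] pf.
  by rewrite big_nil; apply: leG_refl.
rewrite big_cons [size _]/= intS zexpgD.
apply: (@leG_trans (iota a * Dp (size s)%:Z)).
  by apply/leG_mul2l/IH => x xs; apply: pf; rewrite inE xs orbT.
by apply/leG_mulDpow/leG_iota; have [[]] := pf a (mem_head _ _).
Qed.

(** If [k] exceeded inf, [D] would divide the product of the factors. The first factor is the meet
    of that product with [D], so it would equal [D], which a proper simple element cannot. *)
Lemma leG_ginf k f : leG (Dp k) f -> (k <= ginf iota D f)%R.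
Proof.
have [ef pf mf] := normal_formP f; rewrite leNgt => kf; apply/negP => lk.
have : leL D (\prod_(a <- (normal_form iota D f).2) a).
  apply/leG_iota; apply/(leG_mul2l (Dp (ginf iota D f))).
  rewrite gmulf_prod -ef; apply: leG_trans kf.
  by rewrite -[iota D]/(zexpg (iota D) 1%R) /Dpow -zexpgD; apply/leG_Dpow; lia.
case: (_.2) pf mf => [|a s] pf mf.
  by rewrite big_nil => -[c /(mulM_eq1 hM)]; apply: garside_neq1.
have [_ aD aP] := mf 0%N isT; rewrite drop0 in aP => Ds.
have [_ []] := pf a (mem_head _ _); right.
apply: (lattice_anti (garside_latticeL hM)) => //; apply: aP => //.
exact: (lattice_refl (garside_latticeL hM)).
Qed.

(** The boolean [e] bounds the number of factors. A product below [D] is its own meet with [D], that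
    is, its first factor, so by cancellation a second factor would be trivial; a product below 1 has
    no factor at all. *)
Lemma gsup_leG f (e : bool) :
  leG f (Dp (ginf iota D f + e%:Z)%R) ->
  (gsup iota D f <= ginf iota D f + e%:Z)%R.
Proof.
have [ef pf mf] := normal_formP f; rewrite /gsup => fe; rewrite lerD2l lez_nat.
have : leL (\prod_(a <- (normal_form iota D f).2) a) (D ^+ e).
  apply/leG_iota; apply/(leG_mul2l (Dp (ginf iota D f))).
  by rewrite gmulf_prod -ef gmulfXn -[_ ^+ e]/(zexpg _ e%:Z) -zexpgD.
case: (_.2) pf mf => [//|a s] pf mf; rewrite big_cons.
have [[_ aD] a1D] := pf a (mem_head _ _).
case: e {fe} => /=.
  case: s pf mf => [//|b s] pf mf.
  have [_ _ aP] := mf 0%N isT; rewrite drop0 big_cons /= in aP.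
  move=> asD; have [c] := aP _ (lattice_refl (garside_latticeL hM) _) asD.
  rewrite -[RHS]mulg1 -mulgA => /(garside_cancelL hM).
  rewrite big_cons -mulgA => /(mulM_eq1 hM) b1.
  have bs : b \in [:: a, b & s] by rewrite !inE eqxx orbT.
  by have [_ []] := pf b bs; left.
move=> [c]; rewrite -mulgA => /(mulM_eq1 hM) a1.
by case: a1D; left.
Qed.

End GarsideGroupOrder.

(** * Inf and sup over the conjugacy class of a periodic element *)

Section SlimPrecentral.
Variables (M : monoidType) (G : groupType).
Variables (iota : UMagmaMorphism.type M G) (D : M).
Hypothesis hG : garside_group iota D.
Implicit Types (f g h x : G) (v w : int).

Local Notation "'Dp' k" := (Dpow iota D k) (at level 10, k at level 9).
Local Notation inf := (ginf iota D).
Local Notation sup := (gsup iota D).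

Lemma central_DpowM w v : central (Dp w) -> central (Dp (w * v)%R).
Proof. by move=> cw x; rewrite /Dpow zexpgM; apply: zexpgC_central. Qed.

Lemma ginf_periodic f q w : f ^+ q = Dp w -> (inf f * q%:Z <= w)%R.
Proof.
by move=> fq; apply/(leG_Dpow hG); rewrite -fq; apply/leG_DpowX/ginf_leG.
Qed.

Lemma gsup_periodic f q w : f ^+ q = Dp w -> (w <= sup f * q%:Z)%R.
Proof.
by move=> fq; apply/(leG_Dpow hG); rewrite -fq; apply/leG_XDpow/leG_gsup.
Qed.

Lemma inf_sE f h : conj_class f h ->
  (forall x, conj_class f x -> (inf x <= inf h)%R) -> inf_s iota D f = inf h.
Proof.
move=> fh ub; apply: xget_unique; first by split; [exists h|move=> _ [x /ub ? <-]].
move=> _ [[x fx <-] ubx]; apply/eqP; rewrite eq_le ub //=.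
by apply: ubx; exists h.
Qed.

Lemma sup_sE f h : conj_class f h ->
  (forall x, conj_class f x -> (sup h <= sup x)%R) -> sup_s iota D f = sup h.
Proof.
move=> fh lb; apply: xget_unique; first by split; [exists h|move=> _ [x /lb ? <-]].
move=> _ [[x fx <-] lbx]; apply/eqP; rewrite eq_le lb // andbT.
by apply: lbx; exists h.
Qed.

(** By centrality every conjugate [x] of [f] satisfies x^q = D^w, so q inf(x) <= w <= q sup(x).
    Hence inf is at most the floor [v] of w/q and sup at least its ceiling, and [h] attains both. *)
Lemma periodic_summit f h q w v (r : nat) :
    f ^+ q = Dp w -> central (Dp w) -> r < q -> w = (v * q%:Z + r%:Z)%R ->
    conj_class f h -> leG iota (Dp v) h ->
    leG iota h (Dp (v + (0 < r)%:Z)%R) ->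
  [/\ inf h = v, sup h = (v + (0 < r)%:Z)%R,
      inf_s iota D f = inf h & sup_s iota D f = sup h].
Proof.
move=> fq cw rq wE fh vh hv.
have xq x : conj_class f x -> x ^+ q = Dp w.
  by move=> /(conj_classX q); rewrite fq => /(conj_class_central cw).
have infx x : conj_class f x -> (inf x <= v)%R.
  by move=> /xq /ginf_periodic; nia.
have supx x : conj_class f x -> (v + (0 < r)%:Z <= sup x)%R.
  by move=> /xq /gsup_periodic; case: (posnP r) => ?; nia.
have infh : inf h = v by apply/eqP; rewrite eq_le infx // leG_ginf.
have suph : sup h = (v + (0 < r)%:Z)%R.
  apply/eqP; rewrite eq_le supx // andbT -infh.
  by apply: gsup_leG => //; rewrite infh.
split=> //; first by apply: inf_sE => // x; rewrite infh; apply: infx.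
by apply: sup_sE => // x; rewrite suph; apply: supx.
Qed.

(** * Conjugates above D^u of a slim precentral element *)

Variables (g : G) (q : nat) (p u : int).
Hypotheses (q_gt0 : 0 < q) (pE : p = (u * q%:Z + 1)%R).
Hypotheses (gq : g ^+ q = Dp p) (cp : central (Dp p)).

Let good h : Prop := conj_class g h /\ leG iota (Dp u) h.

(* The conjugator is the join x of the elements g^i D^(-ui), 0 <= i < q: left
   multiplication by g and right multiplication by D^(-u) shifts this family by
   one, and sends its last element to g^q D^(-uq) = D, which is above its first
   element 1; so x <= g x D^(-u). *)
Lemma good_exists : exists h, good h.
Proof.
pose F i := g ^+ i * Dp (- u * i%:Z)%R.
have FS i : F i.+1 = g * F i * Dp (- u)%R.
  rewrite /F expgS intS mulrDr mulr1 addrC /Dpow zexpgD !mulgA //.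
have [x [Fx xP]] := join_upto hG F q.-1.
exists (g ^ x); split; first by exists x.
have Fgx i : i <= q.-1 -> leG iota (F i.+1) (g * x * Dp (- u)%R).
  move=> iq; rewrite FS; apply: (leG_mulDpow hG); apply/leG_mul2l.
  exact: Fx.
have : leG iota x (g * x * Dp (- u)%R).
  apply: xP => -[|i] iq; last exact/Fgx/ltnW.
  apply: leG_trans (Fgx _ (leqnn _)).
  rewrite prednK // {2}/F gq /Dpow -zexpgD -/(Dpow iota D _) /F mulr0 mulg1.
  by rewrite -[g ^+ 0]/(Dp 0%R); apply/(leG_Dpow hG); rewrite pE; lia.
(* Multiplying by D^u on the right gives x D^u <= g x, that is, D^u <= x^(-1) g x. *)
move=> /(leG_mulDpow hG u).
by rewrite -mulgA /Dpow -zexpgD addNr mulg1 /leG invgM conjgE !mulgA.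
Qed.

Lemma good_expg h : good h -> h ^+ q = Dp p.
Proof.
by case=> /(conj_classX q); rewrite gq => /(conj_class_central cp).
Qed.

(** Writing k = q k' + r, the relation p = uq + 1 gives pk = q (p k' + u r) + r with r < q, so [v]
    is the floor of pk/q and [e] tells whether the division is inexact. *)
Lemma good_power h k : good h ->
  let v := (p * (k %/ q)%N%:Z + u * (k %% q)%N%:Z)%R in
  let e := ((0 < k %% q)%N%:Z)%R in
  [/\ inf (h ^+ k) = v, sup (h ^+ k) = (v + e)%R,
      inf_s iota D (g ^+ k) = inf (h ^+ k)
    & sup_s iota D (g ^+ k) = sup (h ^+ k)].
Proof.
move=> gh v e; have hq := good_expg gh; case: gh => gh uh.
set r := (k %% q)%N; have rq : r < q by rewrite ltn_mod.
have hk : h ^+ k = Dp (p * (k %/ q)%N%:Z)%R * h ^+ r.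
  by rewrite {1}(divn_eq k q) expgnDr mulnC expgnA hq /Dpow -zexpgMn.
apply: (@periodic_summit _ _ q (p * k%:Z)%R) => //.
- by rewrite -expgnA mulnC expgnA gq /Dpow zexpgMn.
- exact: central_DpowM.
- by rewrite {1}(divn_eq k q) /v -/r; lia.
- exact: conj_classX.
- by rewrite hk /v /Dpow zexpgD; apply/leG_mul2l; apply: leG_DpowX.
rewrite hk /v -addrA /Dpow zexpgD; apply/leG_mul2l; rewrite -/(Dpow iota D _).
have [r0|r_gt0] := posnP r; first by rewrite -/r r0 mulr0; apply: leG_refl.
have : leG iota (h ^+ r * Dp (u * (q - r)%N%:Z)%R) (Dp p).
  rewrite -hq -[in h ^+ q](subnKC (ltnW rq)) expgnDr.
  by apply/leG_mul2l; apply: (leG_DpowX hG).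
move=> /(leG_mulDpow hG (- (u * (q - r)%N%:Z))%R).
rewrite -mulgA /Dpow -!zexpgD subrr mulg1.
by have -> : (p - u * (q - r)%N%:Z = u * r%:Z + 1)%R by rewrite pE; lia.
Qed.

Lemma good_stable h : good h -> stable_summit iota D g h.
Proof.
move=> gh; have pow k : super_summit iota D (g ^+ k) (h ^+ k).
  by have [_ _ iE sE] := good_power k gh; split=> //; apply/conj_classX/gh.1.
by split=> [|k _]; [have := pow 1%N|apply: pow].
Qed.

(** Some good conjugate exists and realises the maximal inf, which is therefore at least [u]. *)
Lemma inf_set_good h : inf_set iota D g h -> good h.
Proof.
move=> [gh infh]; split=> //; apply: leG_trans (ginf_leG hG h).
have [x gx] := good_exists; have [_ _ infg _] := good_power 1%N gx.
apply/(leG_Dpow hG); rewrite infh -[g]/(g ^+ 1%N) infg.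
by apply: leG_ginf => //; apply: gx.2.
Qed.

Lemma goodJ h k : good h -> good (h ^ Dp k).
Proof.
move=> [gh uh]; split; first exact: conj_classJ.
have := positiveJ hG k uh; rewrite conjMg conjVg [Dp u ^ _]conjgE.
by rewrite (zexpg_commute (iota D) u k) mulKg.
Qed.

(** Here sup - inf <= 1 by [good_power] at 1, so h = D^v or h = D^v a with v = inf h. In the second
    case cycling gives D^v (D^v a D^(-v)) = D^v h D^(-v). *)
Lemma good_cycling h : good h -> cycling iota D h = h ^ Dp (- inf h)%R.
Proof.
move=> gh; have [_] := good_power 1%N gh; rewrite expg1 => sup_h _ _.
have [eh _ _] := normal_formP hG h; move: eh sup_h.
rewrite /gsup /cycling -/(ginf iota D h); case: (_.2) => [|a s] /=.
  rewrite big_nil mulg1 => eh _; rewrite [h in RHS]eh conjgE.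
  by rewrite (zexpg_commute (iota D)) mulKg.
have [infh _ _ _] := good_power 1%N gh; rewrite -infh expg1 => eh /addrI [s0].
have {s0} : s = [::] by apply: size0nil; case: (0 < _) s0 => /=; lia.
move=> s0; move: eh; rewrite s0 big_cons !big_nil !mulg1.
set v := inf h => eh; rewrite [h in RHS]eh /tau conjMg [Dp _ ^ _]conjgE.
by rewrite (zexpg_commute (iota D)) mulKg.
Qed.

(** All good elements share the same inf, and conjugating by a power of [D] stays among them, so
    every cycling conjugates by the same power. *)
Lemma good_iter_cycling h n :
  good h -> iter n (cycling iota D) h = h ^ Dp (- inf h * n%:Z)%R.
Proof.
move=> gh; elim: n => [|n IH]; first by rewrite mulr0 conjg1.
have gn : good (h ^ Dp (- inf h * n%:Z)%R) by apply: goodJ.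
rewrite iterS IH good_cycling // -conjgM /Dpow -zexpgD.
have [infn _ _ _] := good_power 1%N gn; have [infh _ _ _] := good_power 1%N gh.
by rewrite (etrans infn (esym infh)) expg1 intS mulrDr mulr1 addrC.
Qed.

(** After [|p|] cyclings the conjugator is a power of the central element D^p. *)
Lemma good_ultra h : good h -> ultra_summit iota D g h.
Proof.
move=> gh; split; first exact: (good_stable gh).1.
have [p0|p0] := eqVneq p 0%R.
  (* The count of cyclings must be positive, so [|p|] does not serve here. Now uq = -1 forces q = 1,
     hence inf h = p = 0, and a single cycling already fixes [h]. *)
  exists 1%N => //; rewrite good_iter_cycling //.
  have [-> _ _ _] := good_power 1%N gh.
  have q1 : q = 1%N.
    have /(congr1 absz) : (u * q%:Z = -1)%R by lia.
    by rewrite abszM => /eqP; rewrite muln_eq1 => /andP[_ /eqP].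
  by rewrite q1 divn1 modn1 p0 !mulr0 addr0 oppr0 mul0r conjg1.
exists `|p|%N; first by rewrite absz_gt0.
rewrite good_iter_cycling // conjgE.
have -> : (- inf h * `|p|%N%:Z = p * (- inf h * Num.sg p))%R.
  by rewrite abszE normrEsg; ring.
by rewrite -(central_DpowM _ cp) mulKg.
Qed.

(** With v = inf h, moving [b] from the front to the back leaves D^v times a positive element, which
    stays above D^v and hence above D^u. *)
Lemma good_partial_cycling h b :
  good h -> partial_cycling_by iota D h b -> good (partial_cycling iota D h b).
Proof.
move=> [gh uh] [a [s [a' [nf aE _ _]]]]; split; first exact: conj_classJ.
have uinf : (u <= inf h)%R by apply: leG_ginf.
apply: leG_trans (_ : leG iota (Dp u) (Dp (inf h))) _; first exact/(leG_Dpow hG).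
have [eh _ _] := normal_formP hG h; move: eh.
rewrite nf -/(ginf iota D h) big_cons aE gmulfM -gmulf_prod.
set v := inf h => eh.
have -> : partial_cycling iota D h b =
    Dp v * (iota a' * iota (\prod_(x <- s) x) * tau iota D (- v)%R (iota b)).
  rewrite /partial_cycling -/v conjgE [h]eh /tau !conjgE /Dpow zexpgN !invgK.
  by rewrite !invgM !invgK !mulgA !mulgVK.
apply: leG_mulr_pos; rewrite -gmulfM; apply: positiveM; first by eexists.
by apply: (positiveJ hG); exists b.
Qed.

End SlimPrecentral.

(** * Centrality from the precentral condition, and the equality of the summit sets *)

Lemma central_exponentP (M : monoidType) (G : groupType)
    (iota : UMagmaMorphism.type M G) (D : M) (p : int) :
  (p = 0 %[mod central_exponent iota D])%Z -> central (Dpow iota D p).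
Proof.
rewrite /central_exponent; case: xgetP => [m _ [[_ cm] _]|_].
  rewrite mod0z => /dvdz_mod0P /dvdzP[k ->].
  by rewrite mulrC; apply: (@central_DpowM _ _ _ _ m%:Z).
(* With the default value 0 the congruence says p = 0, and D^0 = 1 is central. *)
by rewrite !modz0 => -> x; rewrite /commute mul1g mulg1.
Qed.

Theorem theorem3p24 (M : monoidType) (G : groupType)
    (iota : UMagmaMorphism.type M G) (D : M)
    (hG : garside_group iota D) (g : G)
    (hper : periodic iota D g) (hslim : slim iota D g)
    (hpre : precentral iota D g) :
  [/\ inf_set iota D g = super_summit iota D g,
      super_summit iota D g = ultra_summit iota D g,
      ultra_summit iota D g = stable_summit iota D g
    & forall (h : G) (b : M), super_summit iota D g h ->
        partial_cycling_by iota D h b ->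
        super_summit iota D g (partial_cycling iota D h b)].
Proof.
have [p [q [[q_gt0 gq qmin] p1]]] := hslim.
have [p' [q' [[q'_gt0 gq' qmin'] p0]]] := hpre.
(* Slimness and precentrality each supply their own pair. Minimality identifies the denominators. As
   g^q is conjugate to both powers of [D] and D^p' is central, the two powers coincide, so D^p is
   central and equals g^q. *)
have qq' : q' = q.
  apply/eqP; rewrite eqn_leq qmin' //; last by exists p.
  by rewrite qmin //; exists p'.
have cp' := central_exponentP p0; rewrite {}qq' in gq'.
have {}gq' := conj_class_central cp' gq'; rewrite gq' in gq.
have {}gq := conj_class_central cp' (conj_class_sym gq).
rewrite -gq in gq' cp'.
have [u pE] : exists u : int, p = (u * q%:Z + 1)%R.
  exists ((p - 1) %/ q)%Z; rewrite divzK ?subrK //.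
  by rewrite -eqz_mod_dvd; apply/eqP.
pose good h := conj_class g h /\ leG iota (Dpow iota D u) h.
have inf_good h : inf_set iota D g h -> good h.
  exact: (inf_set_good hG q_gt0 pE gq' cp').
have good_st h : good h -> stable_summit iota D g h.
  exact: (good_stable hG q_gt0 pE gq' cp').
have good_u h : good h -> ultra_summit iota D g h.
  exact: (good_ultra hG q_gt0 pE gq' cp').
have super_good h : super_summit iota D g h -> good h.
  by case=> gh infh _; apply: inf_good.
split.
- apply/seteqP; split=> h; last by case.
  by move=> /inf_good/good_st[].
- apply/seteqP; split=> h; last by case.
  by move=> /super_good/good_u.
- apply/seteqP; split=> h [/super_good gh _]; first exact: good_st.
  exact: good_u.
- move=> h b /super_good gh hb; apply: (good_st _ _).1.
  exact: (good_partial_cycling hG gh hb).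
Qed.
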